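(* Let $p\ge 1$ be an integer and let $A\subset\mathbb{R}^p$ be a discrete almost periodic set of finite type (that is, the difference set $A-A=\{a-b:\ a,b\in A\}$ is also discrete). Then $A$ is an ideal crystal: there exist a full rank lattice $L\subset\mathbb{R}^p$ and a finite set $F\subset\mathbb{R}^p$ such that $A=L+F=\{l+f:\ l\in L,\ f\in F\}$.
   Context: A set $A\subset\mathbb{R}^p$ is called discrete if it has no accumulation points in $\mathbb{R}^p$, i.e. every ball of finite radius contains only finitely many points of $A$. A set $E\subset\mathbb{R}^p$ is relatively dense if there is $R<\infty$ such that every ball of radius $R$ in $\mathbb{R}^p$ contains a point of $E$. A continuous function $f$ on $\mathbb{R}^p$ is almost periodic if for every $\varepsilon>0$ the set $\{\tau\in\mathbb{R}^p:\ \sup_{x\in\mathbb{R}^p}|f(x+\tau)-f(x)|<\varepsilon\}$ is relatively dense in $\mathbb{R}^p$. A Borel measure $\mu$ on $\mathbb{R}^p$ is almost periodic if it is almost periodic in the weak sense: for every continuous function $\varphi$ on $\mathbb{R}^p$ with compact support, the function $x\mapsto\int\varphi(x+t)\,d\mu(t)$ is an almost periodic function of $x\in\mathbb{R}^p$. A discrete set $A\subset\mathbb{R}^p$ is almost periodic if its counting measure $\mu_A=\sum_{x\in A}\delta_x$ is almost periodic, where $\delta_x$ is the unit mass at the point $x$. A discrete set $A\subset\mathbb{R}^p$ is of finite type if the set $A-A$ is discrete (in the sense above). A full rank lattice in $\mathbb{R}^p$ is an additive discrete subgroup $L$ of $\mathbb{R}^p$ whose real linear span is $\mathbb{R}^p$.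 A set $A\subset\mathbb{R}^p$ is an ideal crystal if $A=L+F$ with $L$ a full rank lattice and $F$ a finite set. *)

(* Defs.v *)
From HB Require Import structures.
From mathcomp Require Import all_boot all_order all_algebra.
From mathcomp Require Import all_classical all_reals all_analysis.

Set Implicit Arguments.
Unset Strict Implicit.
Unset Printing Implicit Defensive.

Import Order.TTheory GRing.Theory Num.Theory.
Import numFieldNormedType.Exports.

Local Open Scope classical_set_scope.
Local Open Scope ring_scope.

(* R^p is 'rV[R]_p for an arbitrary R : realType.  The library
   norm and balls on 'rV[R]_p are those of the max norm; as R^p is finite
   dimensional, none of the notions below depends on the choice of the norm. *)

Notation borel T := (g_sigma_algebraType (@open T)).

(* This is stronger than discreteness of the subspace topology: an accumulation
   point is excluded whether or not it belongs to A. *)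
Definition discrete_in (T : topologicalType) (A : set T) : Prop :=
  limit_point A = set0.

Definition difference_set (V : zmodType) (A : set V) : set V :=
  [set a - b | a in A & b in A].

Definition finite_type (R : realType) (p : nat) (A : set 'rV[R]_p) : Prop :=
  discrete_in (difference_set A).

Definition relatively_dense (R : realType) (p : nat) (E : set 'rV[R]_p) : Prop :=
  exists r : R, forall x : 'rV[R]_p, ball x r `&` E !=set0.

(* The supremum is taken in the extended reals, so that it is +oo (and not a
   default value) when the difference is unbounded. *)
Definition almost_period (R : realType) (p : nat) (f : 'rV[R]_p -> R) (e : R) :
    set 'rV[R]_p :=
  [set tau | (ereal_sup [set `|f (x + tau) - f x|%:E | x in [set: 'rV[R]_p]]
              < e%:E)%E].

Definition almost_periodic (R : realType) (p : nat) (f : 'rV[R]_p -> R) : Prop :=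
  continuous f /\ forall e : R, 0 < e -> relatively_dense (almost_period f e).

Definition compactly_supported (R : realType) (p : nat) (phi : 'rV[R]_p -> R) :
    Prop :=
  compact (closure [set x | phi x != 0]).

(* The integral is the real-valued one, which is meaningful for measures that
   are finite on compact sets, such as the counting measure of a discrete set. *)
Definition almost_periodic_measure (R : realType) (p : nat)
    (mu : {measure set (borel 'rV[R]_p) -> \bar R}) : Prop :=
  forall phi : 'rV[R]_p -> R, continuous phi -> compactly_supported phi ->
    almost_periodic (fun x : 'rV[R]_p =>
      \int[mu]_(t in [set: borel 'rV[R]_p]) phi (x + t)).

Section set_counting_measure.
Local Open Scope ereal_scope.
Context d (T : measurableType d) (R : realType).
Variable A : set T.

(* The measure \sum_(x in A) delta_x; at B it is the number, possibly +oo, of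
   points of A in B. *)
Definition set_counting (B : set T) : \bar R := \esum_(x in A) \d_x B.

Let set_counting0 : set_counting set0 = 0.
Proof. by apply: esum1 => x _; rewrite measure0. Qed.

Let set_counting_ge0 B : 0 <= set_counting B.
Proof. exact: esum_ge0. Qed.

Let set_counting_sigma_additive : semi_sigma_additive set_counting.
Proof.
move=> F mF tF mUF.
rewrite [X in _ --> X](_ : _ =
  lim ((fun n => \sum_(0 <= i < n) set_counting (F i)) @ \oo)).
  by apply: is_cvg_ereal_nneg_natsum => k _; exact: esum_ge0.
rewrite nneseries_esumT; last by move=> n; exact: esum_ge0.
transitivity (\esum_(x in A) \esum_(i in [set: nat]) (\d_x (F i) : \bar R)).
  apply: eq_esum => x Ax; rewrite -nneseries_esumT//.
  exact: measure_semi_bigcup.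
rewrite /set_counting !esum_esum//.
rewrite (reindex_esum ([set: nat] `*`` fun=> A) _ (fun k => (k.2, k.1)))//.
split=> [[i x] []//|[i x] [j y] _ _ [-> ->]//|[x i] [Ax _]].
by exists (i, x).
Qed.

HB.instance Definition _ := isMeasure.Build _ _ _ set_counting
  set_counting0 set_counting_ge0 set_counting_sigma_additive.

End set_counting_measure.
Arguments set_counting {d T} R A.

Definition almost_periodic_set (R : realType) (p : nat) (A : set 'rV[R]_p) :
    Prop :=
  discrete_in A /\
  almost_periodic_measure (@set_counting _ (borel 'rV[R]_p) R A).

Definition linear_span (R : realType) (p : nat) (L : set 'rV[R]_p) :
    set 'rV[R]_p :=
  [set v | exists s : seq 'rV[R]_p,
    (forall u, u \in s -> L u) /\ v \in span s].

Definition full_rank_lattice (R : realType) (p : nat) (L : set 'rV[R]_p) :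
    Prop :=
  [/\ L 0, (forall x y, L x -> L y -> L (x - y)),
      discrete_in L & linear_span L = setT].

Definition ideal_crystal (R : realType) (p : nat) (A : set 'rV[R]_p) : Prop :=
  exists (L F : set 'rV[R]_p),
    [/\ full_rank_lattice L, finite_set F & A = [set l + f | l in L & f in F]].

(* Main.v *)
Require Import Defs.
From mathcomp Require Import all_boot all_order all_algebra.
From mathcomp Require Import all_classical all_reals all_analysis.
From mathcomp Require Import measurable_realfun lra.

(* Test almost periodicity of the counting measure of A against a tent function
   phi supported in a ball of radius e.  If e is below the minimal distance of A,
   the convolution equals 1 at the points of -A and vanishes farther than e from
   -A, so for a 1-almost period tau every a in A has a partner b in A with
   |b - a + tau| < e, and vice versa.  Since A is relatively dense and A - A has
   only finitely many points of bounded size, for small e the displacements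
   b - a of neighbouring points a coincide; joining distant points by chains,
   b - a is the same for all a, hence an exact period of A within e of -tau.  So
   the group of periods is relatively dense, therefore spans, and it is discrete
   because it lies in A - A; A is a finite union of its cosets. *)

Set Implicit Arguments.
Unset Strict Implicit.
Unset Printing Implicit Defensive.

Import Order.TTheory GRing.Theory Num.Theory.
Import numFieldNormedType.Exports.

Local Open Scope classical_set_scope.
Local Open Scope ring_scope.

(** * Discrete sets: closedness, finiteness in compacts, separation *)

Lemma discrete_in_sub (T : topologicalType) (A B : set T) :
  A `<=` B -> discrete_in B -> discrete_in A.
Proof.
rewrite /discrete_in -!subset0 => AB; apply: subset_trans => x xA U /xA[y [yx Ay Uy]].
by exists y; split=> //; exact: AB.
Qed.

Lemma discrete_in_closed (T : topologicalType) (A : set T) :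
  discrete_in A -> closed A.
Proof.
move=> dA; apply/closure_id.
rewrite eqEsubset; split; first exact: subset_closure.
by rewrite closure_isolated_limit_point dA setU0; exact: isolatedS.
Qed.

Lemma discrete_in_compact_finite (T : topologicalType) (A K : set T) :
  discrete_in A -> compact K -> finite_set (A `&` K).
Proof.
move=> dA cK; apply: contrapT => infAK.
(* A cluster point of the cofinite filter on [A `&` K] is a limit point of A. *)
pose F : set_system T := [set S | finite_set ((A `&` K) `\` S)].
have FF : ProperFilter F.
  split; first by rewrite /F/= setD0.
  split=> [|P Q FP FQ|P Q PQ].
  - by rewrite /F/= setDT.
  - by rewrite /F/= setDIr finite_setU.
  - by apply: sub_finite_set; exact: setDS.
have FK : F K by rewrite /F/= -setIDA setDv setI0.
have [x [_ xF]] := cK F FF FK.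
have : ~ limit_point A x by rewrite dA.
apply=> U xU.
have FAx : F (A `\ x).
  apply: (@sub_finite_set _ _ [set x]) => // y [[Ay Ky]] /not_andP[//|].
  exact: contrapT.
have [y [[Ay /eqP yx] Uy]] := xF _ _ FAx xU.
by exists y.
Qed.

Lemma closed_le_norm (R : realType) (V : normedModType R) (r : R) :
  closed [set x : V | `|x| <= r].
Proof.
have -> : [set x : V | `|x| <= r] = closed_ball_ Num.norm 0 r.
  by apply/seteqP; split=> x; rewrite /closed_ball_/= sub0r normrN.
exact: closed_closed_ball_.
Qed.

Lemma compact_le_norm (R : realType) (p : nat) (r : R) :
  compact [set x : 'rV[R]_p | `|x| <= r].
Proof.
apply: bounded_closed_compact; last exact: closed_le_norm.
exists r; split; first exact: num_real.
by move=> s rs x /= /le_trans; apply; exact: ltW.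
Qed.

Lemma seq_pos_lbound (R : realFieldType) (s : seq R) :
  exists2 e : R, 0 < e & forall x, x \in s -> 0 < x -> e <= x.
Proof.
elim: s => [|y s [e e0 es]]; first by exists 1.
have [y0|y0] := ltP 0 y.
- exists (Num.min e y); first by rewrite lt_min e0.
  move=> x; rewrite inE ge_min => /predU1P[-> _|xs x0]; first by rewrite lexx orbT.
  by rewrite es.
- exists e => // x; rewrite inE => /predU1P[->|]; last exact: es.
  by rewrite ltNge y0.
Qed.

Lemma finite_set_separated (R : realType) (V : normedModType R) (D : set V) :
  finite_set D -> exists2 e : R, 0 < e &
    forall u v, D u -> D v -> `|u - v| < e -> u = v.
Proof.
case/finite_seqP => s ->.
(* [e] is a lower bound of the finitely many positive distances in [D]. *)
have [e e0 es] := seq_pos_lbound [seq `|u - v| | u <- s, v <- s].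
exists e => // u v us vs uve; apply/eqP; rewrite -subr_eq0 -normr_eq0.
apply: contraTT uve => uv0; rewrite -leNgt es ?lt0r ?uv0 ?normr_ge0//.
exact: allpairs_f.
Qed.

(** * Integration against the counting measure *)

Section set_counting_theory.
Variables (R : realType) (p : nat) (A : set 'rV[R]_p).
Local Notation mu := (@set_counting _ (borel 'rV[R]_p) R A).

Lemma open_measurable_borel (U : set 'rV[R]_p) :
  open U -> measurable (U : set (borel 'rV[R]_p)).
Proof. by move=> oU; exact: sub_sigma_algebra. Qed.

Lemma continuous_measurable_borel (f : 'rV[R]_p -> R) :
  continuous f -> measurable_fun setT (f : borel 'rV[R]_p -> R).
Proof.
move=> cf; apply: (measurability _ (RGenOpens.measurableE R)) => //.
move=> _ [_ [a [b ->]] <-]; rewrite setTI.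
apply: open_measurable_borel; apply: open_comp => [x _|]; [exact: cf|exact: interval_open].
Qed.

Lemma set_counting_setC : mu (~` A) = 0%E.
Proof.
by apply: esum1 => x Ax; rewrite diracE memNset//=; exact.
Qed.

Lemma set_counting_set1 (a : 'rV[R]_p) : A a -> mu [set a] = 1%E.
Proof.
move=> Aa; rewrite /set_counting (esumID [set a])//.
rewrite setIC -(_ : [set a] = [set a] `&` A); last first.
  by rewrite setIidl// => x ->.
rewrite esum_set1// esum1 ?adde0; first by rewrite diracE mem_set.
by move=> x [_ xa]; rewrite diracE memNset.
Qed.

Hypothesis cA : closed A.

(** As [A] is closed, its complement is a Borel null set, so agreement on [A] is agreement almost
    everywhere. Integrals are evaluated this way, by passing to a simpler integrand, without writing
    them as sums over [A]. *)
Lemma eq_Rintegral_set_counting (f g : borel 'rV[R]_p -> R) :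
  measurable_fun setT f -> measurable_fun setT g ->
  {in A, f =1 g} ->
  \int[mu]_(t in setT) f t = \int[mu]_(t in setT) g t.
Proof.
move=> mf mg fg; congr fine; apply: ae_eq_integral => //.
- exact: measurableT_comp.
- exact: measurableT_comp.
- exists (~` A); split.
  + by apply: open_measurable_borel; exact: closed_openC.
  + exact: set_counting_setC.
  + move=> t /= ntfg At; apply: ntfg => _.
    by rewrite fg// inE.
Qed.

End set_counting_theory.

(** * Relatively dense sets span the space *)

Lemma mx_entry_le_norm (R : realDomainType) (m n : nat) (x : 'M[R]_(m, n)) i j :
  `|x i j| <= mx_norm x.
Proof.
by rewrite mx_normrE; apply/bigmax_geP; right => /=; exists (i, j).
Qed.

Lemma linear_rV_bounded (R : realType) (p : nat) (V : normedModType R)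
    (g : {linear 'rV[R]_p -> V}) :
  exists C : R, forall u, `|g u| <= C * `|u|.
Proof.
exists (\sum_j `|g (delta_mx 0 j)|) => u.
rewrite [in leLHS](row_sum_delta u) linear_sum mulr_suml.
apply: le_trans (ler_norm_sum _ _ _) _; apply: ler_sum => j _.
by rewrite linearZ normrZ mulrC ler_wpM2l//; exact: mx_entry_le_norm.
Qed.

(** Otherwise every free sequence in [L] could be extended, eventually beyond the dimension of
    [vT]. *)
Lemma exists_spanning_seq (K : fieldType) (vT : vectType K) (L : set vT) :
  exists s : seq vT, (forall u, u \in s -> L u) /\
    forall u, L u -> u \in span s.
Proof.
apply: contrapT => H.
have grow n : exists s : seq vT,
    [/\ forall u, u \in s -> L u, free s & size s = n].
  elim: n => [|n [s [sL sfree <-]]]; first by exists [::]; rewrite nil_free.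
  have [u [Lu us]] : exists u, L u /\ u \notin span s.
    apply: contrapT => Hs; apply: H; exists s; split=> // u Lu.
    by apply: contrapT => /negP us; apply: Hs; exists u.
  exists (u :: s); split=> //=; last by rewrite free_cons us.
  by move=> v; rewrite inE => /predU1P[->|/sL].
have [s [_ /eqP sfree sn]] := grow (\dim {:vT}).+1.
by have := dimvS (subvf (span s)); rewrite sfree sn ltnn.
Qed.

Lemma relatively_dense_linear_span (R : realType) (p : nat)
    (L : set 'rV[R]_p) :
  relatively_dense L -> linear_span L = setT.
Proof.
move=> [r Lr]; rewrite -subTset => v _.
have [s [sL Ls]] := exists_spanning_seq L.
exists s; split=> //.
(* [g] vanishes exactly on the span of [s]. Each multiple [n v] is within [r] of a point of [L],
   where [g] is zero, so [n |g v|] is bounded in [n] and [g v = 0]. *)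
pose g : {linear 'rV[R]_p -> 'rV[R]_p} := (\1 - projv (span s))%VF.
have gE u : g u = u - projv (span s) u by rewrite /= add_lfunE opp_lfunE id_lfunE.
have [C gC] := linear_rV_bounded g.
have gb n : n%:R * `|g v| <= `|C| * r.
  have [u] := Lr (n%:R *: v); rewrite -ball_normE /= => -[ur Lu].
  have gu : g u = 0 by rewrite gE projv_id ?subrr//; exact: Ls.
  have -> : n%:R * `|g v| = `|g (n%:R *: v - u)|.
    by rewrite linearB/= gu subr0 linearZ/= normrZ normr_nat.
  rewrite (le_trans (gC _))// (le_trans (ler_wpM2r _ (ler_norm C)))//.
  by rewrite ler_wpM2l// ltW.
suff gv0 : g v = 0.
  by move/eqP: gv0; rewrite gE subr_eq0 => /eqP ->; exact: memv_proj.
apply/eqP; rewrite -normr_eq0; apply/negP => /negP gv0.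
have gv : 0 < `|g v| by rewrite lt0r gv0 normr_ge0.
set x := `|C| * r / `|g v|.
have := gb (Num.bound `|x|).
rewrite -ler_pdivlMr// leNgt => /negP; apply.
exact: le_lt_trans (ler_norm x) (archi_boundP (normr_ge0 x)).
Qed.

(** * Tent functions and approximate translates *)

Section tent.
Variables (R : realType) (p : nat).

Definition tent (e : R) (x : 'rV[R]_p) : R := Num.max 0 (1 - `|x| / e).

Lemma tent0 e : tent e 0 = 1.
Proof. by rewrite /tent normr0 mul0r subr0 max_r. Qed.

Lemma tent_eq0 e x : 0 < e -> e <= `|x| -> tent e x = 0.
Proof.
by move=> e0 ex; rewrite /tent max_l// subr_le0 ler_pdivlMr// mul1r.
Qed.

Lemma continuous_tent e : continuous (tent e).
Proof.
move=> x; apply: (@continuous_max _ _ (fun=> 0) (fun x => 1 - `|x| / e)).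
  exact: (@cst_continuous _ _ _ x).
apply: (@cvgB R R^o _ (nbhs x) _ (fun=> 1) (fun x => `|x| / e)); first exact: cvg_cst.
by apply: cvgMr_tmp; exact: norm_continuous.
Qed.

Lemma compactly_supported_tent e : 0 < e -> compactly_supported (tent e).
Proof.
move=> e0.
apply: (@subclosed_compact _ _ [set x | `|x| <= e]).
- exact: closed_closure.
- exact: compact_le_norm.
- rewrite closureE; apply: smallest_sub; first exact: closed_le_norm.
  by move=> x /=; apply: contra_neqT; rewrite -ltNge => /ltW; exact: tent_eq0.
Qed.

End tent.

Section near_translates.
Variables (R : realType) (p : nat) (A : set 'rV[R]_p) (e : R).
Hypothesis e0 : 0 < e.
Hypothesis sepA : forall a b, A a -> A b -> `|a - b| < e -> a = b.
Local Notation mu := (@set_counting _ (borel 'rV[R]_p) R A).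
Local Notation f :=
  (fun x : 'rV[R]_p => \int[mu]_(t in [set: borel 'rV[R]_p]) tent e (x + t)).

Lemma measurable_fun_tent_shift (x : 'rV[R]_p) :
  measurable_fun setT ((fun t => tent e (x + t)) : borel 'rV[R]_p -> R).
Proof.
apply: continuous_measurable_borel => t.
apply: (@continuous_comp _ _ _ (fun t => x + t)); last exact: continuous_tent.
by apply: (@cvgD R _ _ (nbhs t) _ (fun=> x) id); [exact: cvg_cst|exact: cvg_id].
Qed.

(** By separation, [a] is the only point of [A] closer than [e] to [a], so the shifted tent agrees
    on [A] with the indicator of [a]. *)
Lemma Rintegral_tent_point (a : 'rV[R]_p) : closed A -> A a -> f (- a) = 1.
Proof.
move=> cA Aa.
have ma : measurable ([set a] : set (borel 'rV[R]_p)).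
  rewrite -[X in measurable X]setCK; apply: measurableC.
  apply: open_measurable_borel; apply: closed_openC.
  apply: accessible_closed_set1; apply: hausdorff_accessible.
  exact: norm_hausdorff.
rewrite (@eq_Rintegral_set_counting _ _ _ cA _ \1_[set a]).
- by rewrite /Rintegral integral_indic// setIT/= set_counting_set1.
- exact: measurable_fun_tent_shift.
- exact: measurable_indic.
- move=> t; rewrite inE => At; rewrite indicE.
  have [->|ta] := eqVneq t a; first by rewrite addNr tent0 mem_set.
  rewrite memNset/=; last exact/eqP.
  rewrite tent_eq0// leNgt addrC; apply: contra_neqN ta => /sepA.
  exact.
Qed.

Lemma Rintegral_tent_near (x : 'rV[R]_p) : closed A -> f x != 0 ->
  exists2 b, A b & `|x + b| < e.
Proof.
move=> cA; apply: contra_neqP => H.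
rewrite (@eq_Rintegral_set_counting _ _ _ cA _ (fun=> 0)).
- by rewrite Rintegral_cst// mul0r.
- exact: measurable_fun_tent_shift.
- exact: measurable_cst.
- move=> t; rewrite inE => At; rewrite tent_eq0// leNgt; apply/negP => xt.
  by apply: H; exists t.
Qed.

Lemma almost_periodic_set_near_translates : almost_periodic_set A ->
  relatively_dense [set tau |
    (forall a, A a -> exists2 b, A b & `|b - a + tau| < e) /\
    (forall b, A b -> exists2 a, A a & `|b - a + tau| < e)].
Proof.
move=> [dA].
move=> /(_ _ (continuous_tent (e:=e)) (compactly_supported_tent e0)).
have cA := discrete_in_closed dA.
move=> [_ /(_ 1 ltr01) [r Hr]]; exists r => x.
have [tau [xtau tauE]] := Hr x; exists tau; split=> //=.
have close y : `|f (y + tau) - f y| < 1.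
  rewrite -lte_fin; apply: le_lt_trans tauE; apply: ereal_sup_ubound.
  by exists y.
split=> [a Aa|b Ab].
- have := close (- a); rewrite (Rintegral_tent_point cA Aa) => fa.
  have /(Rintegral_tent_near cA)[b Ab ab] : f (- a + tau) != 0.
    by apply: contraTneq fa => ->; rewrite sub0r normrN normr1 ltxx.
  by exists b => //; rewrite -addrA addrC.
(* The base point is chosen so that translation by [tau] lands on [- b], where the convolution is
   1. *)
- have := close (- b - tau); rewrite subrK (Rintegral_tent_point cA Ab) => fb.
  have /(Rintegral_tent_near cA)[a Aa ab] : f (- b - tau) != 0.
    by apply: contraTneq fb => ->; rewrite subr0 normr1 ltxx.
  exists a => //; rewrite -normrN; congr (_ < _): ab; congr `|_|.
  by rewrite !opprD opprK addrAC addrC.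
Qed.

End near_translates.

(** * The group of periods, and propagation from neighbours to all points *)

Section periods.
Variables (V : zmodType) (A : set V).

Definition periods : set V := [set t | forall x, A (x + t) <-> A x].

Lemma periods0 : periods 0.
Proof. by move=> x; rewrite addr0. Qed.

Lemma periodsB s t : periods s -> periods t -> periods (s - t).
Proof.
move=> As At x; rewrite addrA.
apply: iff_trans (As x).
by apply: iff_trans (iff_sym (At _)) _; rewrite subrK.
Qed.

Lemma periods_difference_set : A !=set0 -> periods `<=` difference_set A.
Proof.
move=> [a Aa] t At; exists (a + t); first exact/At.
by exists a; rewrite // [a + t]addrC addrK.
Qed.

End periods.

(* Rather than chaining points a directly, the induction subdivides the segment
   between centres x, x' and picks an a near each subdivision point. *)
Lemma locally_constant_relation (R : realType) (V : normedModType R) (T : Type)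
    (P : V -> T -> Prop) (r : R) :
  (forall x, exists a d, `|x - a| < r /\ P a d) ->
  (forall a a' d d', P a d -> P a' d' -> `|a - a'| < 2 * r + 1 -> d = d') ->
  forall a a' d d', P a d -> P a' d' -> d = d'.
Proof.
move=> dP cP.
have step n : forall x x' a a' d d', `|x - x'| <= n%:R ->
    `|x - a| < r -> `|x' - a'| < r -> P a d -> P a' d' -> d = d'.
  elim: n => [|n IH] x x' a a' d d' xx' xa x'a' Pad Pad'.
    apply: cP Pad Pad' _; move: xx'; rewrite normr_le0 subr_eq0 => /eqP xx'.
    rewrite -xx' distrC in x'a'.
    have := ler_distD x a a'; rewrite [`|a - x|]distrC [`|x - a'|]distrC; lra.
  (* [y] is one [n.+1]-th of the way from [x] to [x']: at most 1 from [x] and at most [n] from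
     [x']. *)
  pose y := x + n.+1%:R^-1 *: (x' - x).
  have n0 : (0 : R) < n.+1%:R by rewrite ltr0n.
  have xy : `|x - y| <= 1.
    rewrite /y opprD addrA subrr sub0r normrN normrZ.
    rewrite ger0_norm; last by rewrite invr_ge0 ltW.
    by rewrite ler_pdivrMl// mulr1 distrC.
  have yx' : `|y - x'| <= n%:R.
    have -> : y - x' = (1 - n.+1%:R^-1) *: (x - x').
      by rewrite /y scalerBl scale1r -[x' - x]opprB scalerN addrAC.
    rewrite normrZ ger0_norm; last first.
      by rewrite subr_ge0 invf_le1// ler1n.
    rewrite -(ler_pM2l n0) mulrA mulrBr mulr1 divff ?gt_eqF// -natr1 addrK.
    by rewrite mulrC natr1 ler_wpM2r.
  have [b [e [yb Pbe]]] := dP y.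
  rewrite (cP _ _ _ _ Pad Pbe); first exact: IH yx' yb x'a' Pbe Pad'.
  have := ler_distD x a b; have := ler_distD y x b.
  rewrite [`|a - x|]distrC; lra.
move=> a a' d d' Pad Pad'.
have r0 : 0 < r by have [b [e [/(le_lt_trans (normr_ge0 _))]]] := dP 0.
apply: (step (Num.bound `|a - a'|) a a' a a') => //; rewrite ?subrr ?normr0//.
exact/ltW/archi_boundP.
Qed.

(** * From approximate translates to exact periods *)

Section exact_periods.
Variables (R : realType) (p : nat) (A : set 'rV[R]_p).
Hypotheses (A0 : A !=set0) (hap : almost_periodic_set A) (hft : finite_type A).

Lemma finite_type_separated (r : R) : exists2 e, 0 < e &
  forall u v, difference_set A u -> difference_set A v ->
    `|u| <= r -> `|v| <= r -> `|u - v| < e -> u = v.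
Proof.
have [e e0 sep] :=
  finite_set_separated (discrete_in_compact_finite hft (@compact_le_norm R p r)).
by exists e => // u v Du Dv ur vr; apply: sep.
Qed.

Lemma finite_type_uniformly_discrete : exists2 e, 0 < e &
  forall a b, A a -> A b -> `|a - b| < e -> a = b.
Proof.
have [e e0 sep] := finite_type_separated 1.
(* The difference [a - b] is compared with [0 = a - a]; the cap 1 keeps it in the ball where [sep]
   applies. *)
exists (Num.min e 1); first by rewrite lt_min e0 ltr01.
move=> a b Aa Ab; rewrite lt_min => /andP[abe ab1].
apply/eqP; rewrite -subr_eq0; apply/eqP; apply: sep; rewrite ?subr0 ?normr0//.
- by exists a => //; exists b.
- by exists a => //; exists a; rewrite // subrr.
- exact: ltW.
Qed.

Lemma almost_periodic_set_relatively_dense : relatively_dense A.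
Proof.
have [e e0 sep] := finite_type_uniformly_discrete.
have [r Hr] := almost_periodic_set_near_translates e0 sep hap.
have [a Aa] := A0.
(* The partner [b] of [a] is near [a - tau], hence near [x] once [tau] is near [a - x]. *)
exists (r + e) => x; have [tau [+ [/(_ a Aa) [b Ab abe] _]]] := Hr (a - x).
rewrite -ball_normE /= => xtau; exists b; split=> //.
rewrite /ball_/=.
have -> : x - b = - (a - x - tau) - (b - a + tau).
  by apply/rowP => j; rewrite !mxE; lra.
rewrite (le_lt_trans (ler_normB _ _))// normrN; lra.
Qed.

Lemma periods_relatively_dense : relatively_dense (periods A).
Proof.
have [r Ar] := almost_periodic_set_relatively_dense.
have [e1 e10 sep1] := finite_type_uniformly_discrete.
(* Neighbours satisfy [|a - a'| < 2 * r + 1], and their displacements differ by less than [2 * e],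
   which is at most 1 and at most [e2]. So the differences of the two points and of their partners
   both have norm at most [2 * r + 2]. *)
have [e2 e20 sep2] := finite_type_separated (2 * r + 2).
pose e := Num.min e1 (Num.min (e2 / 2) (1 / 2)).
have e0 : 0 < e by rewrite !lt_min e10 !divr_gt0.
have [ee1 ee2 e1h] : [/\ e <= e1, e <= e2 / 2 & e <= 1 / 2].
  by rewrite /e !ge_min !lexx !orbT.
have sep a b : A a -> A b -> `|a - b| < e -> a = b.
  by move=> Aa Ab ab; apply: sep1 => //; exact: lt_le_trans ee1.
have [s Hs] := almost_periodic_set_near_translates e0 sep hap.
exists (s + e) => y; have [tau [+ [fwd bwd]]] := Hs y.
rewrite -ball_normE /= => ytau.
pose P a d := [/\ A a, A (a + d) & `|d + tau| < e].
have PA a : A a -> exists d, P a d.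
  move=> Aa; have [b Ab ab] := fwd a Aa.
  by exists (b - a); split=> //; rewrite [a + _]addrC subrK.
have PP : forall a a' d d', P a d -> P a' d' -> d = d'.
  apply: (@locally_constant_relation _ _ _ P r) => [x|a a' d d'].
    have [a [+ Aa]] := Ar x; rewrite -ball_normE /= => xa.
    by have [d Pad] := PA a Aa; exists a, d.
  move=> [Aa Aad dtau] [Aa' Aad' d'tau] aa'.
  have dd' : `|d - d'| < e + e.
    have -> : d - d' = (d + tau) - (d' + tau) by rewrite opprD addrACA subrr addr0.
    by rewrite (le_lt_trans (ler_normB _ _))// ltrD.
  have E : (a + d) - (a' + d') = (a - a') + (d - d') by rewrite opprD addrACA.
  (* Both sides lie in [A - A] and differ by [d - d'], too short for distinct elements of this
     size. *)
  have /(congr1 (fun z => z - (a - a'))) : (a + d) - (a' + d') = a - a'.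
    apply: sep2.
    - by exists (a + d) => //; exists (a' + d').
    - by exists a => //; exists a'.
    - by rewrite E (le_trans (ler_normD _ _))//; lra.
    - lra.
    - by rewrite E addrAC subrr add0r; lra.
  by rewrite E addrAC subrr add0r => /eqP; rewrite subr_eq0 => /eqP.
have [a0 Aa0] := A0; have [d Pd] := PA a0 Aa0.
exists (- d); split.
  rewrite /ball_/=.
  have -> : y - - d = (y - tau) + (d + tau).
    by rewrite opprK [d + tau]addrC addrA subrK.
  have [_ _ dtau] := Pd.
  by rewrite (le_lt_trans (ler_normD _ _))// ltrD.
rewrite /= -sub0r; apply: periodsB; first exact: periods0.
move=> x; split=> [Axd|Ax].
  (* The point [a] whose partner is [x + d] also has displacement [d], so [a = x]. *)
  have [a Aa ax] := bwd _ Axd.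
  have Pa : P a (x + d - a) by split=> //; rewrite [a + _]addrC subrK.
  by have /(canRL (addrK _)) := PP _ _ _ _ Pa Pd; rewrite opprK addrC => /addrI ->.
by have [d' Pd'] := PA x Ax; rewrite (PP _ _ _ _ Pd Pd'); have [] := Pd'.
Qed.

Lemma periods_full_rank_lattice : full_rank_lattice (periods A).
Proof.
split.
- exact: periods0.
- exact: periodsB.
- exact: discrete_in_sub (periods_difference_set A0) hft.
- exact: relatively_dense_linear_span periods_relatively_dense.
Qed.

Lemma nonempty_ideal_crystal : ideal_crystal A.
Proof.
have [r Pr] := periods_relatively_dense.
(* Every point of [A] can be moved by a period into the ball of radius [r] about 0, so the points of
   [A] there represent all cosets. *)
exists (periods A), (A `&` [set x | `|x| <= r]); split.
- exact: periods_full_rank_lattice.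
- by case: hap => dA _; exact: discrete_in_compact_finite dA (@compact_le_norm R p r).
- apply/seteqP; split=> [a Aa|_ [t At [f [Af _] <-]]]; last by rewrite addrC; exact/At.
  have [t []] := Pr a; rewrite -ball_normE /= => at_r At.
  exists t => //; exists (a - t); last by rewrite addrC subrK.
  by split; [apply/At; rewrite subrK|exact: ltW].
Qed.

End exact_periods.

(** * The integer lattice, for the case of empty [A] *)

Lemma uniformly_discrete_discrete_in (R : realType) (V : normedModType R)
    (D : set V) (e : R) : 0 < e ->
  (forall x y, D x -> D y -> `|x - y| < e -> x = y) -> discrete_in D.
Proof.
move=> e0 sep; rewrite /discrete_in -subset0 => x xD.
have [y [yx Dy]] := xD _ (nbhsx_ballx x (e / 2) (divr_gt0 e0 (ltr0n _ 2))).
rewrite -ball_normE /= => xy.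
have xy0 : 0 < `|x - y| by rewrite normr_gt0 subr_eq0 eq_sym.
(* [z] is strictly closer to [x] than [y] is, yet within [e] of [y], which contradicts
   separation. *)
have [z [_ Dz]] := xD _ (nbhsx_ballx x `|x - y| xy0).
rewrite -ball_normE /= => xz; move: (xz).
rewrite (sep z y) ?ltxx// (le_lt_trans (ler_distD x _ _))// distrC.
by lra.
Qed.

Lemma int_points_full_rank_lattice (R : realType) (p : nat) :
  full_rank_lattice [set v : 'rV[R]_p | forall j, v 0 j \is a Num.int].
Proof.
split.
- by move=> j; rewrite mxE.
- by move=> x y xZ yZ j; rewrite !mxE rpredB.
- apply: (uniformly_discrete_discrete_in ltr01) => x y xZ yZ xy.
  apply/rowP => j; apply/eqP; rewrite -subr_eq0; apply: contraTT xy => xyj.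
  rewrite -leNgt; apply: le_trans (mx_entry_le_norm (x - y) 0 j).
  by rewrite !mxE norm_intr_ge1 ?rpredB.
- apply: relatively_dense_linear_span; exists 1 => x.
  exists (\row_j (Num.floor (x 0 j))%:~R); split=> /=.
    split=> // i j; rewrite (ord1 i) mxE -ball_normE /=.
    have := floor_itv (x 0 j); rewrite intrD => /andP[? ?].
    by rewrite ger0_norm; lra.
  by move=> j; rewrite mxE; exact: intr_int.
Qed.

Theorem theorem2 (R : realType) (p : nat) (hp : (1 <= p)%N) (A : set 'rV[R]_p)
  (hap : almost_periodic_set A) (hft : finite_type A) : ideal_crystal A.
Proof.
(* Every vector is a period of the empty set, so its periods are not a lattice when [p] is positive;
   the integer points with empty [F] serve instead. *)
have [->|/set0P A0] := eqVneq A set0; last exact: nonempty_ideal_crystal.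
exists [set v : 'rV[R]_p | forall j, v 0 j \is a Num.int], set0; split.
- exact: int_points_full_rank_lattice.
- exact: finite_set0.
- by apply/seteqP; split=> // x [l _ [f []]].
Qed.
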